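(* Let $K$ be a finite simple connected graph with $n$ vertices, where $n\ge 5$, such that $K$ is isomorphic neither to the $n$-vertex path $P_n$ nor to the $n$-vertex cycle $C_n$. If $G$ is the line graph of $K$, then $$ABS(G)>ABC(G).$$
   Context: For a finite simple graph $G$ with edge set $\mathbf{E}(G)$, let $d_u$ denote the degree of the vertex $u$ in $G$. The atom-bond-connectivity index is $ABC(G)=\sum_{uv\in \mathbf{E}(G)}\sqrt{\frac{d_u+d_v-2}{d_u d_v}}$ and the atom-bond sum-connectivity index is $ABS(G)=\sum_{uv\in \mathbf{E}(G)}\sqrt{\frac{d_u+d_v-2}{d_u+d_v}}$. The line graph of $K$ is the graph whose vertices are the edges of $K$, two of them being adjacent if and only if they are distinct and share an endpoint in $K$. *)

(* Defs.v *)
From mathcomp Require Import all_boot all_order all_algebra.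

Set Implicit Arguments.
Unset Strict Implicit.
Unset Printing Implicit Defensive.

Import GRing.Theory Num.Theory.
Local Open Scope ring_scope.

Record sgraph := SGraph {
  vertex :> finType;
  adj : rel vertex;
  adj_sym : symmetric adj;
  adj_irrefl : irreflexive adj
}.
Arguments adj {s}.

Definition edges (G : sgraph) : {set {set G}} :=
  [set [set p.1; p.2] | p : G * G & adj p.1 p.2].

Definition degree (G : sgraph) (u : G) : nat := #|[set v | adj u v]|.

Definition connected (G : sgraph) : Prop := forall u v : G, connect adj u v.

Definition isomorphic (G H : sgraph) : Prop :=
  exists2 f : G -> H, bijective f & forall u v, adj (f u) (f v) = adj u v.

Section PathCycle.
Variable n : nat.

Definition path_adj : rel 'I_n :=
  fun i j => (i.+1 == j)%N || (j.+1 == i)%N.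

Lemma path_adj_sym : symmetric path_adj.
Proof. by move=> i j; rewrite /path_adj orbC. Qed.

Lemma path_adj_irrefl : irreflexive path_adj.
Proof. by move=> i; rewrite /path_adj orbb gtn_eqF. Qed.

Definition path_graph : sgraph := SGraph path_adj_sym path_adj_irrefl.

(* The conjunct [i != j] only matters for [n = 1], where it removes the loop;
   the cycle graph proper is the case [3 <= n]. *)
Definition cycle_adj : rel 'I_n :=
  fun i j => (i != j) && ((i.+1 %% n == j)%N || (j.+1 %% n == i)%N).

Lemma cycle_adj_sym : symmetric cycle_adj.
Proof. by move=> i j; rewrite /cycle_adj eq_sym orbC. Qed.

Lemma cycle_adj_irrefl : irreflexive cycle_adj.
Proof. by move=> i; rewrite /cycle_adj eqxx. Qed.

Definition cycle_graph : sgraph := SGraph cycle_adj_sym cycle_adj_irrefl.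
End PathCycle.

Section LineGraph.
Variable K : sgraph.

Definition edge_type : finType := {A : {set K} | A \in edges K}.

Definition line_adj : rel edge_type :=
  fun A B => (A != B) && (val A :&: val B != set0).

Lemma line_adj_sym : symmetric line_adj.
Proof. by move=> A B; rewrite /line_adj eq_sym setIC. Qed.

Lemma line_adj_irrefl : irreflexive line_adj.
Proof. by move=> A; rewrite /line_adj eqxx. Qed.

Definition line_graph : sgraph := SGraph line_adj_sym line_adj_irrefl.
End LineGraph.

(* An edge is a two-element set [A = [set u; v]], so the sum (product) of the
   degrees over [A] is d_u + d_v (d_u d_v): see [sum_edge] and [prod_edge]. *)
Definition ABC (R : rcfType) (G : sgraph) : R :=
  \sum_(A in edges G)
    Num.sqrt ((\sum_(u in A) (degree u)%:R - 2) / \prod_(u in A) (degree u)%:R).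

Definition ABS (R : rcfType) (G : sgraph) : R :=
  \sum_(A in edges G)
    Num.sqrt ((\sum_(u in A) (degree u)%:R - 2) / \sum_(u in A) (degree u)%:R).

Lemma adj_neq (G : sgraph) (u v : G) : adj u v -> u != v.
Proof. by apply: contraTneq => ->; rewrite adj_irrefl. Qed.

Lemma sum_edge (R : rcfType) (G : sgraph) (u v : G) (F : G -> R) :
  adj u v -> \sum_(w in [set u; v]) F w = F u + F v.
Proof. by move=> /adj_neq uv; rewrite big_setU1 ?inE //= big_set1. Qed.

Lemma prod_edge (R : rcfType) (G : sgraph) (u v : G) (F : G -> R) :
  adj u v -> \prod_(w in [set u; v]) F w = F u * F v.
Proof. by move=> /adj_neq uv; rewrite big_setU1 ?inE //= big_set1. Qed.

Lemma mem_edges (G : sgraph) (u v : G) : ([set u; v] \in edges G) = adj u v.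
Proof.
apply/imsetP/idP => [[[x y]] /= | uv]; last by exists (u, v); rewrite ?inE.
rewrite inE /= => xy E.
have X : x \in [set u; v] by rewrite E !inE eqxx.
have Y : y \in [set u; v] by rewrite E !inE eqxx orbT.
move: X Y (adj_neq xy); rewrite !inE.
case/pred2P=> ?; case/pred2P=> ?; subst; rewrite ?eqxx //.
by rewrite adj_sym.
Qed.

(* Main.v *)
Require Import Defs.
From mathcomp Require Import all_boot all_order all_algebra.
From mathcomp Require Import ring lra zify.

Set Implicit Arguments.
Unset Strict Implicit.
Unset Printing Implicit Defensive.

Import Order.TTheory GRing.Theory Num.Theory.
Local Open Scope ring_scope.

(* An edge of G with end degrees x, y contributes
   sqrt ((x+y-2)/(x+y)) - sqrt ((x+y-2)/(xy)) to ABS - ABC.  This gap is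
   nonnegative when x, y >= 2 and nondecreasing there in each variable, and
   negative only on pendant edges, where the loss is at most the value at
   (1, 2).  Every leaf of G comes from a pendant thread of K of length at least
   2; the thread ends at a branch vertex w of K (degree >= 3), since K is
   neither a path nor a cycle.  Distinct leaves yield distinct last edges of
   threads, and each such last edge is a vertex of G of degree >= 3 lying in the
   clique of the edges at w, hence has at least two neighbours of degree >= 2.
   The gain on the edges of G towards these neighbours outweighs the losses. *)

(** * Numerical bounds for the contribution of one edge *)

Section EdgeWeight.
Variable R : rcfType.

Lemma ler_sqrt_sqr (a x : R) : 0 <= a -> a ^+ 2 <= x -> a <= Num.sqrt x.
Proof. by move=> a0 ax; rewrite -(ger0_norm a0) -sqrtr_sqr ler_wsqrtr. Qed.

Lemma sqrt_ler_sqr (a x : R) : 0 <= a -> x <= a ^+ 2 -> Num.sqrt x <= a.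
Proof. by move=> a0 ax; rewrite -(ger0_norm a0) -sqrtr_sqr ler_wsqrtr. Qed.

Definition weight_gap (x y : R) : R :=
  Num.sqrt ((x + y - 2) / (x + y)) - Num.sqrt ((x + y - 2) / (x * y)).

Lemma weight_gapC x y : weight_gap x y = weight_gap y x.
Proof. by rewrite /weight_gap (addrC x) (mulrC x). Qed.

Lemma weight_gap_ge0 x y : 2 <= x -> 2 <= y -> 0 <= weight_gap x y.
Proof.
move=> x2 y2; rewrite subr_ge0 ler_wsqrtr //.
by rewrite ler_wpM2l ?lef_pV2 ?posrE; nra.
Qed.

(** The first radicand grows with [x + y] and is at least 3/5; the second is at most 1/2 because
    [(x - 2) * (y - 2) >= 0]. The decimals bracket these two roots. *)
Lemma weight_gap_23 x y : 3 <= x -> 2 <= y -> 67 / 1000 <= weight_gap x y.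
Proof.
move=> x3 y2.
have : 7745 / 10000 <= Num.sqrt ((x + y - 2) / (x + y)).
  by apply: ler_sqrt_sqr; [lra | rewrite ler_pdivlMr; nra].
have : Num.sqrt ((x + y - 2) / (x * y)) <= 7072 / 10000.
  by apply: sqrt_ler_sqr; [lra | rewrite ler_pdivrMr; nra].
rewrite /weight_gap; lra.
Qed.

(** The radicands are at least 2/3 and at most 4/9. The bound is twice 67/1000 because such an edge
    is credited once for each end. *)
Lemma weight_gap_33 x y : 3 <= x -> 3 <= y -> 134 / 1000 <= weight_gap x y.
Proof.
move=> x3 y3.
have : 816 / 1000 <= Num.sqrt ((x + y - 2) / (x + y)).
  by apply: ler_sqrt_sqr; [lra | rewrite ler_pdivlMr; nra].
have : Num.sqrt ((x + y - 2) / (x * y)) <= 2 / 3.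
  by apply: sqrt_ler_sqr; [lra | rewrite ler_pdivrMr; nra].
rewrite /weight_gap; lra.
Qed.

Lemma weight_gap_11 : weight_gap 1 1 = 0.
Proof. by rewrite /weight_gap (_ : 1 + 1 - 2 = 0) ?mul0r ?subrr //; ring. Qed.

Lemma weight_gap_1n (n : nat) : (1 < n)%N -> - (13 / 100) <= weight_gap 1 n%:R.
Proof.
move=> n2; rewrite /weight_gap mul1r; set y : R := n%:R.
have y2 : 2 <= y by rewrite ler_nat.
(* Integrality is needed: the bound [(y - 1) / (y (y + 1)) <= 1 / 6] below
   fails for [2 < y < 3]. *)
have y23 : 0 <= (y - 2) * (y - 3).
  have [n3|n3] := leqP n 2.
    by rewrite /y (_ : n = 2%N) ?subrr ?mul0r //; lia.
  have : 3 <= y by rewrite ler_nat.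
  nra.
have -> : 1 + y - 2 = y - 1 by ring.
set q := (y - 1) / (1 + y); set s := Num.sqrt q.
have s577 : 577 / 1000 <= s.
  by apply: ler_sqrt_sqr; [lra | rewrite ler_pdivlMr; nra].
have q0 : 0 <= q by rewrite divr_ge0; lra.
have sq : s ^+ 2 = q by rewrite sqr_sqrtr.
suff : Num.sqrt ((y - 1) / y) <= s + 13 / 100 by lra.
(* After squaring, it remains to bound [(y - 1) / (y * (1 + y))] by [26 / 100 * s + 169 / 10000].
   The left side is at most 1/6, with equality at 2 and 3, and [s >= 577 / 1000] just suffices. *)
apply: sqrt_ler_sqr; first lra.
have -> : (y - 1) / y = q + (y - 1) / (y * (1 + y)).
  by rewrite /q; field; apply/andP; split; apply/lt0r_neq0; lra.
have : (y - 1) / (y * (1 + y)) <= 1 / 6 by rewrite ler_pdivrMr; nra.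
by rewrite -sq; lra.
Qed.

(* [67 / 1000] is slightly below the gap at [(2, 3)] and [13 / 100] slightly
   above the loss at [(1, 2)]; what matters is that [13 / 100 < 2 * 67 / 1000]. *)
Lemma weight_gap_lb (x y : nat) : (0 < x)%N -> (0 < y)%N ->
  67 / 1000 * ((2 < x) && (1 < y))%N%:R - 13 / 100 * (x == 1%N)%:R +
  (67 / 1000 * ((2 < y) && (1 < x))%N%:R - 13 / 100 * (y == 1%N)%:R)
    <= weight_gap x%:R y%:R.
Proof.
have geN k m : (k <= m)%N -> (k%:R : R) <= m%:R by rewrite ler_nat.
wlog xy : x y / (x <= y)%N.
  move=> H x0 y0; case: (leqP x y) => [/H|/ltnW /H]; first exact.
  by rewrite weight_gapC addrC; exact.
case: x xy => // -[|[|x]] xy _.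
- case: y xy => // -[|y] _ _ /=; first by rewrite weight_gap_11; lra.
  have := @weight_gap_1n y.+2 isT.
  by rewrite andbF /=; lra.
- case: y xy => // -[//|[|y]] _ _ /=.
    by have := @weight_gap_ge0 2 2 (lexx _) (lexx _); lra.
  have := @weight_gap_23 y.+3%:R 2 (geN 3%N y.+3 isT) (lexx _).
  by rewrite weight_gapC /=; lra.
case: y xy => // -[//|[//|y]] _ _ /=.
have := @weight_gap_33 x.+3%:R y.+3%:R (geN 3%N x.+3 isT) (geN 3%N y.+3 isT).
lra.
Qed.

End EdgeWeight.

(** * Degrees, edges and darts (ordered pairs of adjacent vertices) *)

Section Graphs.
Variable G : sgraph.
Implicit Types u v w : G.

Lemma leq_degree u (s : seq G) : uniq s -> all (adj u) s -> (size s <= degree u)%N.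
Proof.
move=> us /allP as_; rewrite /degree cardE; apply: uniq_leq_size => // v /as_ uv.
by rewrite mem_enum inE.
Qed.

Lemma degree_gt0 u v : adj u v -> (0 < degree u)%N.
Proof. by move=> uv; rewrite (@leq_degree u [:: v]) //= uv. Qed.

Lemma edgeP (A : {set G}) :
  reflect (exists2 p : G * G, adj p.1 p.2 & A = [set p.1; p.2]) (A \in edges G).
Proof.
apply: (iffP imsetP) => [[p]|[p pa ->]]; first by rewrite inE => ? ->; exists p.
by exists p; rewrite ?inE.
Qed.

Lemma set2_eq (T : finType) (a b c d : T) :
  [set a; b] = [set c; d] -> (a = c /\ b = d) \/ (a = d /\ b = c).
Proof.
move=> /setP E; move: (E a) (E b) (E c) (E d); rewrite !inE !eqxx !orbT /=.
move=> /esym/pred2P[] -> /esym/pred2P[] ->; rewrite ?eqxx ?orbb ?orbT; auto.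
- by move=> _ /eqP ->; auto.
- by move=> /eqP ->; auto.
Qed.

(** Exactly two darts, [(u, v)] and [(v, u)], lie over an edge. Passing to darts lets each end of an
    edge be charged separately. *)
Lemma sum_darts (R : nmodType) (F : {set G} -> R) :
  \sum_(p : G * G | adj p.1 p.2) F [set p.1; p.2] = (\sum_(A in edges G) F A) *+ 2.
Proof.
transitivity (\sum_(p in [set p : G * G | adj p.1 p.2]) F [set p.1; p.2]).
  by apply: eq_bigl => p; rewrite inE.
rewrite (partition_big_imset (fun p : G * G => [set p.1; p.2])) /= -sumrMnl.
apply: eq_bigr => A /edgeP[[u v] /= uv ->].
rewrite (eq_bigr (fun=> F [set u; v])) => [|p /andP[_ /eqP-> //]].
rewrite big_const_seq iter_addr addr0; congr (_ *+ _).
rewrite -sum1_count big_mkcondr /= -big_mkcondr /= sum1_card.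
transitivity #|[set (u, v); (v, u)]|.
  apply: eq_card => -[a b]; rewrite !inE !xpair_eqE unfold_in /= inE /=.
  apply/andP/idP => [[_ /eqP/set2_eq[[-> ->]|[-> ->]]]|]; rewrite ?eqxx ?orbT //.
  by case/orP => /andP[/eqP-> /eqP->]; rewrite ?(adj_sym v) uv // setUC.
by rewrite cards2 xpair_eqE negb_and (adj_neq uv).
Qed.

Lemma connected_closed (P : pred G) u : connected G -> P u ->
  (forall v w, P v -> adj v w -> P w) -> forall v, P v.
Proof.
move=> cG Pu cl v; have /connectP[s] := cG u v.
elim: s u Pu => [|w s IH] u Pu /=; first by move=> _ ->.
by case/andP=> /(cl _ _ Pu) Pw /IH; apply.
Qed.

End Graphs.

(** * Lower bound for the difference of the indices by counting darts *)

Definition leaf_darts (G : sgraph) : {set G * G} :=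
  [set p | adj p.1 p.2 & degree p.1 == 1%N].

Definition heavy_darts (G : sgraph) : {set G * G} :=
  [set p | [&& adj p.1 p.2, 2 < degree p.1 & 1 < degree p.2]]%N.

Lemma sum_dartsC (V : nmodType) (G : sgraph) (F : G -> G -> V) :
  \sum_(p : G * G | adj p.1 p.2) F p.1 p.2 = \sum_(p : G * G | adj p.1 p.2) F p.2 p.1.
Proof.
rewrite (reindex_inj (h := fun p : G * G => (p.2, p.1))) /=; last by move=> [? ?] [? ?] [-> ->].
by apply: eq_bigl => p; rewrite adj_sym.
Qed.

(** Twice the difference is the sum of [weight_gap] over darts. Each term is at least [h] of the
    dart plus [h] of its reverse, and both parts have the same total since reversal permutes the
    darts; the factor 2 cancels. *)
Lemma ABS_sub_ABC_lb (R : rcfType) (G : sgraph) :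
  67 / 1000 * #|heavy_darts G|%:R - 13 / 100 * #|leaf_darts G|%:R
    <= ABS R G - ABC R G.
Proof.
pose h (A B : G) : R := 67 / 1000 * ((2 < degree A) && (1 < degree B))%N%:R
  - 13 / 100 * (degree A == 1%N)%:R.
have sum_h : \sum_(p : G * G | adj p.1 p.2) h p.1 p.2 =
    67 / 1000 * #|heavy_darts G|%:R - 13 / 100 * #|leaf_darts G|%:R.
  rewrite sumrB -!mulr_sumr -!natr_sum -!big_mkcondr /= !sum1_card.
  by congr (_ * _%:R - _ * _%:R); apply: eq_card => p; rewrite !inE.
have gap : (ABS R G - ABC R G) *+ 2 =
    \sum_(p : G * G | adj p.1 p.2) weight_gap (degree p.1)%:R (degree p.2)%:R.
  rewrite mulrnBl sumrB; congr (_ - _); apply: etrans (esym (sum_darts _)) _;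
    by apply: eq_bigr => p AB; rewrite !(sum_edge _ AB) ?(prod_edge _ AB).
rewrite -(ler_pMn2r (n := 2)) // gap -sum_h mulr2n {2}sum_dartsC -big_split /=.
apply: ler_sum => p AB; have BA : adj p.2 p.1 by rewrite adj_sym.
exact: weight_gap_lb (degree_gt0 AB) (degree_gt0 BA).
Qed.


(** * Threads from leaves to branch vertices *)

Section Threads.
Variable G : sgraph.
Implicit Types p q s t : G * G.

(* A thread is followed dart by dart through vertices of degree 2. *)
Definition dart_step p q :=
  [&& adj p.1 p.2, adj q.1 q.2, q.1 == p.2, degree p.2 == 2 & q.2 != p.1]%N.

Lemma connect_step_inv s t : connect dart_step s t ->
  t = s \/ exists2 r, connect dart_step s r & dart_step r t.
Proof.
case/connectP => c; case/lastP: c => [_ ->|c r]; first by left.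
rewrite rcons_path last_rcons => /andP[sc cr] ->; right.
by exists (last s c) => //; apply/connectP; exists c.
Qed.

(** Two distinct predecessors of [(c, d)] would give [c] three neighbours [a], [a'], [d], whereas
    its degree is 2. *)
Lemma dart_step_inj p q t : dart_step p t -> dart_step q t -> p = q.
Proof.
case: p q t => [a b] [a' b'] [c d] /and5P[/= ab cd /eqP cb /eqP b2 da].
case/and5P => /= a'b' _ /eqP cb' _ da'; subst b b'.
congr (_, _); apply: contra_eq b2 => aa'; rewrite gtn_eqF //.
rewrite (@leq_degree _ _ [:: a; a'; d]) //= ?(adj_sym c a) ?(adj_sym c a') ?ab ?a'b' ?cd //.
by rewrite !inE negb_or aa' eq_sym da eq_sym da'.
Qed.

(** The default [t] makes a dart without predecessor a fixed point, so backward iteration rests at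
    the start of a thread. *)
Definition dart_back t := odflt t [pick r | dart_step r t].

Lemma dart_backK p q : dart_step p q -> dart_back q = p.
Proof.
move=> pq; rewrite /dart_back; case: pickP => [r rq|/(_ p)]; last by rewrite pq.
exact: dart_step_inj rq pq.
Qed.

Lemma dart_back_leaf s : degree s.1 = 1%N -> dart_back s = s.
Proof.
move=> s1; rewrite /dart_back; case: pickP => //= r /and5P[_ _ /eqP rs /eqP].
by rewrite -rs s1.
Qed.

Lemma connect_iter_back s t : connect dart_step s t ->
  exists m, s = iter m dart_back t.
Proof.
case/connectP => c; elim/last_ind: c t => [|c r IH] t /=; first by move=> _ ->; exists 0%N.
rewrite rcons_path last_rcons => /andP[sc cr] ->.
have [m ->] := IH _ sc erefl.
by exists m.+1; rewrite iterSr (dart_backK cr).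
Qed.

(* Following a thread backwards is deterministic and stops at its leaf. *)
Lemma connect_leaf_inj s s' t : degree s.1 = 1%N -> degree s'.1 = 1%N ->
  connect dart_step s t -> connect dart_step s' t -> s = s'.
Proof.
move=> s1 s1' /connect_iter_back[m Em] /connect_iter_back[m' Em'].
wlog le : s s' m m' s1 s1' Em Em' / (m <= m')%N.
  move=> H; case: (leqP m m') => [|/ltnW] le; first exact: (H s s' m m').
  by apply/esym; apply: (H s' s m' m).
have fix_back k : iter k dart_back s = s by elim: k => //= k ->; apply: dart_back_leaf.
by rewrite Em' -(subnK le) iterD -Em fix_back.
Qed.

(* Otherwise the vertices met by the thread starting at [s] would be closed
   under adjacency, and all of them have degree at most 2. *)
Lemma thread_exit s (w : G) : connected G -> (2 < degree w)%N ->
  adj s.1 s.2 -> degree s.1 = 1%N ->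
  exists2 t, connect dart_step s t & (2 < degree t.2)%N.
Proof.
move=> cG w3 s12 s1.
case: (pickP [pred t : G * G | connect dart_step s t & 2 < degree t.2]%N) => [t /andP[st t3]|none].
  by exists t.
have le2 t : connect dart_step s t -> (degree t.2 <= 2)%N.
  by move=> st; have := none t; rewrite /= st /= => /negbT; rewrite -leqNgt.
have adjr t : connect dart_step s t -> adj t.1 t.2.
  by case/connect_step_inv => [->//|[r _ /and5P[]]].
pose P v := (v == s.1) || [exists t : G * G, connect dart_step s t && (t.2 == v)].
have Ptail t : connect dart_step s t -> P t.1.
  case/connect_step_inv => [->|[r sr /and5P[_ _ /eqP -> _ _]]].
    by rewrite /P eqxx.
  by apply/orP; right; apply/existsP; exists r; rewrite sr eqxx.
have Phead t : connect dart_step s t -> P t.2.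
  by move=> st; apply/orP; right; apply/existsP; exists t; rewrite st eqxx.
suff /(_ w) : forall v, P v.
  case/orP => [/eqP ws|/existsP[t /andP[/le2 tw /eqP ew]]].
    by rewrite ws s1 in w3.
  by rewrite ew leqNgt w3 in tw.
apply: (connected_closed cG (u := s.1)); first by rewrite /P eqxx.
move=> v z /orP[/eqP-> s1z|/existsP[t /andP[st /eqP <-]] tz].
  have -> : z = s.2; last exact: Phead.
  apply: contra_eq s1 => zs; rewrite gtn_eqF // (@leq_degree _ _ [:: z; s.2]) //=.
    by rewrite inE zs.
  by rewrite s1z s12.
have [->|zt] := eqVneq z t.1; first exact: Ptail.
suff st' : dart_step t (t.2, z) by apply: (Phead (t.2, z)); apply: connect_trans st (connect1 st').
rewrite /dart_step /= adjr // tz eqxx zt andbT eqn_leq le2 //=.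
rewrite (@leq_degree _ _ [:: t.1; z]) //= ?inE 1?eq_sym ?zt //.
by rewrite adj_sym adjr // tz.
Qed.

(** Each leaf dart is sent to a dart where its thread reaches a branch vertex; the existence of [w]
    guarantees one, and [connect_leaf_inj] makes the map injective. *)
Lemma card_leaf_threads (w : G) : connected G -> (2 < degree w)%N ->
  (#|[set p : G * G | [&& adj p.1 p.2, degree p.1 == 1 & degree p.2 == 2]]|
   <= #|[set p : G * G | [&& adj p.1 p.2, degree p.1 == 2 & 2 < degree p.2]]|)%N.
Proof.
move=> cG w3; set S := [set p | _]; set X := [set p | _].
pose f s := odflt s [pick t : G * G | connect dart_step s t && (2 < degree t.2)%N].
have fP s : s \in S -> connect dart_step s (f s) /\ (2 < degree (f s).2)%N.
  rewrite inE => /and3P[s12 /eqP s1 _]; rewrite /f; case: pickP => [t /andP[]//|].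
  have [t st t3] := thread_exit cG w3 s12 s1.
  by move/(_ t); rewrite st t3.
have f_inj : {in S &, injective f}.
  move=> s s' sS s'S fss'; have [[sf _] [s'f _]] := (fP s sS, fP s' s'S).
  rewrite -fss' in s'f; move: sS s'S; rewrite !inE => /and3P[_ /eqP s1 _] /and3P[_ /eqP s1' _].
  exact: connect_leaf_inj s1 s1' sf s'f.
rewrite -(card_in_imset f_inj); apply/subset_leq_card/subsetP => t /imsetP[s sS ->].
(* The exit dart differs from [s], whose head has degree 2, so it has a predecessor; a step always
   passes through a vertex of degree 2, which is the tail of the exit dart. *)
have [/connect_step_inv[E|[r _ /and5P[_ a12 /eqP e r2 _]]] f3] := fP s sS.
  by move: sS; rewrite -E inE => /and3P[_ _ /eqP E2]; rewrite E2 in f3.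
by rewrite inE f3 a12 e r2.
Qed.

End Threads.

(** * Connected graphs of maximum degree at most 2 *)

Section LowDegree.
Variable G : sgraph.

Lemma isomorphic_sym (H K : sgraph) : isomorphic H K -> isomorphic K H.
Proof.
case=> f [g fK gK] fadj; exists g; first by exists f.
by move=> u v; rewrite -fadj !gK.
Qed.

Lemma longest_path (x : G) : exists2 s : seq G, [&& uniq s, sorted adj s & s != [::]] &
  forall t : seq G, uniq t -> sorted adj t -> (size t <= size s)%N.
Proof.
pose P m := [exists t : m.-tuple G, uniq t && sorted adj t].
have P1 : P 1%N by apply/existsP; exists [tuple x].
have Pm m : P m -> (m <= #|G|)%N.
  by case/existsP => t /andP[/card_uniqP + _]; rewrite size_tuple => <-; apply: max_card.
case: (ex_maxnP (ex_intro P _ P1) Pm) => m /existsP[t /andP[ut st]] mx.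
exists t.
  rewrite ut st /=; apply: contraTneq (mx _ P1) => /(congr1 size).
  by rewrite size_tuple => ->.
move=> s us ss; rewrite size_tuple; apply: mx.
by apply/existsP; exists (in_tuple s); rewrite us ss.
Qed.

(** The vertex set of a longest path is closed under adjacency: a neighbour [w] outside it would
    prolong the path if [v] is an end, and would be a third neighbour of [v] otherwise. *)
Lemma hamiltonian_path (x : G) : connected G -> (forall v : G, (degree v <= 2)%N) ->
  exists s : seq G, [/\ uniq s, sorted adj s & forall v, v \in s].
Proof.
move=> cG le2; have [s /and3P[us ss s0] mx] := longest_path x.
exists s; split=> //; apply: (connected_closed cG (u := head x s)).
  by case: (s) s0 => // a l _; rewrite inE eqxx.
move=> v w vs vw; apply: contraT => ws.
have [s1 [s2 Es]] : exists s1, exists s2, s = s1 ++ v :: s2.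
  by case/splitPr: vs => s1 s2; exists s1, s2.
case/lastP: s1 Es => [|s1 a] Es.
  have : uniq (w :: s) by rewrite /= ws.
  have ws_path : sorted adj (w :: s) by move: ss; rewrite Es /= (adj_sym w) vw.
  by move=> /mx /(_ ws_path); rewrite /= ltnn.
case: s2 Es => [|b s2] Es.
  have : uniq (rcons s w) by rewrite rcons_uniq ws.
  move/mx; rewrite size_rcons ltnn; apply.
  case: (s) s0 Es ss => // c l _ Es ss; rewrite /= rcons_path; apply/andP; split=> //.
  by have -> : last c l = v by rewrite -[last c l]/(last x (c :: l)) Es last_cat.
have: (degree v <= 2)%N by [].
rewrite leqNgt (@leq_degree _ _ [:: a; b; w]) //=.
  have : uniq [:: a; b].
    apply: subseq_uniq us; rewrite Es cat_rcons.
    by apply: subseq_trans (suffix_subseq s1 _); rewrite /= !eqxx;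
      case: (b == v); rewrite /= ?eqxx ?sub0seq.
  rewrite /= !inE !negb_or !andbT => -> /=.
  by apply/andP; split; apply: contraNneq ws => <-;
    rewrite Es !(mem_cat, mem_rcons, inE) eqxx ?orbT.
move: ss; rewrite Es -cats1 -catA /= => /cat_sorted2[_ /=].
by rewrite adj_sym => /and3P[-> -> _]; rewrite vw.
Qed.

(** Vertices are numbered along a Hamiltonian path. The only possible further edge joins its two
    ends, and its presence decides between cycle and path. *)
Lemma path_or_cycle : (2 < #|G|)%N -> connected G -> (forall v : G, (degree v <= 2)%N) ->
  isomorphic G (path_graph #|G|) \/ isomorphic G (cycle_graph #|G|).
Proof.
move=> n3 cG le2.
have /card_gt0P[x _] : (0 < #|G|)%N by lia.
have [s [us ss sG]] := hamiltonian_path x cG le2.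
have sz : size s = #|G|.
  by rewrite -(card_uniqP us); apply: eq_card => v; rewrite sG.
set n := #|G| in n3 sz *.
pose f (i : 'I_n) := nth x s i.
have f_lt (i : 'I_n) : (i < size s)%N by rewrite sz.
have f_bij : bijective f.
  have ix v : (index v s < n)%N by rewrite -sz index_mem.
  exists (fun v => Ordinal (ix v)) => [i|v]; last by rewrite /f /= nth_index.
  by apply: val_inj; rewrite /= index_uniq.
have consec k : (k.+1 < n)%N -> adj (nth x s k) (nth x s k.+1).
  by rewrite -sz => kn; apply: (sortedP x ss).
have neq a b : (a < n)%N -> (b < n)%N -> a <> b -> nth x s a != nth x s b.
  by move=> an bn ab; rewrite nth_uniq ?sz //; apply/eqP.
(* A chord at an inner vertex of the path would be its third edge. *)
have far i j : (i < n)%N -> (j < n)%N -> (i.+1 < j)%N -> adj (nth x s i) (nth x s j) ->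
    i = 0%N /\ j.+1 = n.
  move=> ni nj ij aij; split.
    case: i ni ij aij => // i ni ij aij; have := le2 (nth x s i.+1).
    rewrite leqNgt (@leq_degree _ _ [:: nth x s i; nth x s i.+2; nth x s j]) //=.
      by rewrite !inE negb_or !neq //; lia.
    by rewrite aij adj_sym !consec //; lia.
  case: (ltnP j.+1 n) => nj1; last by lia.
  have := le2 (nth x s j); case: j nj ij aij nj1 => // j nj ij aij nj1.
  rewrite leqNgt (@leq_degree _ _ [:: nth x s j; nth x s j.+2; nth x s i]) //=.
    by rewrite !inE negb_or !neq //; lia.
  by rewrite (adj_sym _ (nth x s i)) aij adj_sym !consec //; lia.
have [a0|a0] := boolP (adj (nth x s 0) (nth x s n.-1)); [right|left];
    apply: isomorphic_sym; exists f => // i j; rewrite /f.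
- wlog ij : i j / (i <= j)%N.
    move=> H; case: (leqP i j) => [|/ltnW]; first exact: H.
    by rewrite adj_sym (adj_sym i); apply: H.
  rewrite [RHS]/= /cycle_adj -val_eqE /=.
  have [->|ne] := eqVneq (i : nat) j; first by rewrite adj_irrefl.
  have ijn : (i.+1 < n)%N by move: (ltn_ord j); lia.
  rewrite (modn_small ijn) /=.
  have [<-|ne1] := eqVneq i.+1 (j : nat); first by rewrite consec.
  have [jn|jn] := eqVneq j.+1 n.
    rewrite jn modnn (congr1 predn jn : j = n.-1 :> nat).
    have [<-|i0] := eqVneq 0%N (i : nat); first by rewrite a0.
    by apply/negP => /far; rewrite ltn_ord; lia.
  rewrite modn_small; last by move: (ltn_ord j) jn => ? /eqP; lia.
  by apply/idP/eqP => [/far[]|]; rewrite ?ltn_ord; lia.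
wlog ij : i j / (i <= j)%N.
  move=> H; case: (leqP i j) => [|/ltnW]; first exact: H.
  by rewrite adj_sym (adj_sym i); apply: H.
rewrite [RHS]/= /path_adj.
have [->|ne] := eqVneq (i : nat) j; first by rewrite adj_irrefl; lia.
have [e|ne1] := eqVneq i.+1 (j : nat).
  by rewrite -e consec // e.
rewrite [RHS](_ : _ = false); last by lia.
apply/negP => aij; have [i0 jn] : (i : nat) = 0%N /\ j.+1 = n by apply: far; rewrite ?ltn_ord //; lia.
by move: a0; rewrite -(congr1 predn jn : j = n.-1 :> nat) -{1}i0 aij.
Qed.

End LowDegree.

(** * Degrees and dart counts in the line graph *)

Section LineGraphDegrees.
Variable K : sgraph.
Implicit Types (x y z : K) (A B : line_graph K).

Definition line_vertex x y (xy : adj x y) : line_graph K :=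
  exist _ [set x; y] (etrans (mem_edges x y) xy).

Lemma line_vertexP A : exists x, exists y, adj x y /\ val A = [set x; y].
Proof. by have /edgeP[[x y] /= xy E] := valP A; exists x, y. Qed.

Lemma line_adjE A B : adj A B = (val A != val B) && (val A :&: val B != set0).
Proof. by rewrite val_eqE. Qed.

Lemma set2_injr x : injective (fun z => [set x; z]).
Proof. by move=> a b /set2_eq[[]|[<-]]. Qed.

(** The other edges at [x] and the other edges at [y] form the families [Sx] and [Sy]; they are
    disjoint, as an edge in both would be [A] itself. *)
Lemma degree_line A x y : adj x y -> val A = [set x; y] ->
  degree A = ((degree x).-1 + (degree y).-1)%N.
Proof.
move=> xy Axy; have neq := adj_neq xy.
rewrite /degree -(card_imset _ (@val_inj _ _ (edge_type K))).
pose N u v := [set z : K | adj u z] :\ v.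
have cardN u v : adj u v -> #|N u v| = (degree u).-1.
  by move=> uv; rewrite /degree (cardsD1 v [set z | adj u z]) inE uv.
rewrite -!/(degree _) -(cardN x y) // -(cardN y x) ?(adj_sym y) //.
rewrite -(card_imset _ (@set2_injr x)) -(card_imset _ (@set2_injr y)).
set Sx := [set [set x; z] | z in N x y]; set Sy := [set [set y; z] | z in N y x].
have dis : Sx :&: Sy = set0.
  apply/setP => S; rewrite !inE; apply/negP => /andP[/imsetP[a aN ->] /imsetP[b bN]].
  move: aN bN; rewrite !inE => /andP[ay _] /andP[bx _] /set2_eq[[e _]|[e _]].
    by rewrite e eqxx in neq.
  by rewrite e eqxx in bx.
have -> : (#|Sx| + #|Sy| = #|Sx :|: Sy|)%N by rewrite cardsU dis cards0 subn0.
apply: eq_card => S; apply/imsetP/setUP => [[B]|].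
  rewrite inE line_adjE Axy => /andP[AB /set0Pn[w]] wAB ->.
  have [a [b [ab E]]] := line_vertexP B; rewrite E in AB wAB *.
  wlog wa : a b ab {E} AB wAB / w = a.
    move=> H; move: (wAB); rewrite inE => /andP[_ /set2P[wa|wb]]; first exact: (H a b).
    by rewrite setUC; apply: (H b a); rewrite 1?adj_sym 1?(setUC [set b]).
  rewrite wa in wAB; move: wAB; rewrite inE => /andP[/set2P[ax|ay] _]; [left|right];
    apply/imsetP; exists b; rewrite ?ax ?ay // !inE -?ax -?ay ab andbT.
  - by apply: contraNneq AB => ->; rewrite ax.
  - by apply: contraNneq AB => ->; rewrite ay setUC.
case=> /imsetP[z]; rewrite !inE => /andP[zn uz] ->.
  exists (line_vertex uz) => //; rewrite inE line_adjE Axy /=; apply/andP; split.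
    by apply: contraNneq zn => /set2_injr ->.
  by apply/set0Pn; exists x; rewrite !inE eqxx.
exists (line_vertex uz) => //; rewrite inE line_adjE Axy /=; apply/andP; split.
  by rewrite setUC; apply: contraNneq zn => /set2_injr ->.
by apply/set0Pn; exists y; rewrite !inE eqxx orbT.
Qed.

Lemma degree_line_vertex x y (xy : adj x y) :
  degree (line_vertex xy) = ((degree x).-1 + (degree y).-1)%N.
Proof. exact: (@degree_line (line_vertex xy)). Qed.

(** Besides [x], the vertex [y] has two more neighbours; the edges from [y] to them meet [A], and
    each has degree at least [(degree y).-1], hence at least 2. *)
Lemma line_branch_neighbors A x y : adj x y -> val A = [set x; y] ->
  (2 < degree y)%N -> (1 < #|[set B | adj A B && (1 < degree B)]|)%N.
Proof.
move=> xy Axy y3.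
have : (1 < #|[set z | adj y z] :\ x|)%N.
  by move: y3; rewrite /degree (cardsD1 x) inE adj_sym xy.
case/card_gt1P => z1 [z2 []]; rewrite !inE => /andP[z1x yz1] /andP[z2x yz2] z12.
have good z (yz : adj y z) : z != x ->
    line_vertex yz \in [set B | adj A B && (1 < degree B)%N].
  move=> zx; rewrite inE line_adjE Axy /= degree_line_vertex.
  apply/andP; split; last by have := degree_gt0 yz; lia.
  apply/andP; split; last by apply/set0Pn; exists y; rewrite !inE eqxx orbT.
  by rewrite setUC; apply: contraNneq zx => /set2_injr ->.
apply/card_gt1P; exists (line_vertex yz1), (line_vertex yz2); split; try exact: good.
by rewrite -val_eqE /=; apply: contraNneq z12 => /set2_injr ->.
Qed.

(** A leaf of the line graph has a single dart, and its end degrees in [K] sum to 3, so they are 1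
    and 2. *)
Lemma card_line_leaves : connected K -> (2 < #|K|)%N ->
  (#|leaf_darts (line_graph K)| <=
   #|[set p : K * K | [&& adj p.1 p.2, degree p.1 == 1 & degree p.2 == 2]]|)%N.
Proof.
move=> cK n3; set S := [set p | _].
have inj : {in leaf_darts (line_graph K) &, injective (fun p => val p.1)}.
  move=> [A B] [A' B']; rewrite !inE /= => /andP[AB /eqP A1] /andP[AB' /eqP A1'] /val_inj e.
  subst A'; congr (_, _); apply: contra_eq A1 => BB'; rewrite gtn_eqF //.
  by rewrite (@leq_degree _ _ [:: B; B']) //= ?inE ?BB' // AB AB'.
rewrite -(card_in_imset inj); apply: leq_trans (leq_imset_card (fun p => [set p.1; p.2]) _).
apply/subset_leq_card/subsetP => _ /imsetP[[A B] + ->] /=; rewrite inE /= => /andP[AB /eqP A1].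
have [x [y [xy E]]] := line_vertexP A.
have := degree_line xy E; rewrite A1 => d.
have yx : adj y x by rewrite adj_sym.
have x0 := degree_gt0 xy; have y0 := degree_gt0 yx.
apply/imsetP; case: (ltnP (degree x) (degree y)) => lt.
  by exists (x, y); rewrite // inE /= xy; lia.
by exists (y, x); rewrite ?E ?(setUC [set y]) // inE /= yx; lia.
Qed.

(** The unequal end degrees orient these edges, so distinct darts give distinct edges. Each edge has
    degree at least 1 + 2 in the line graph, and [line_branch_neighbors] supplies two heavy darts
    leaving it. *)
Lemma card_heavy_darts :
  (#|[set p : K * K | [&& adj p.1 p.2, degree p.1 == 2 & 2 < degree p.2]]| * 2
   <= #|heavy_darts (line_graph K)|)%N.
Proof.
set X := [set p | _].
have inj : {in X &, injective (fun p : K * K => [set p.1; p.2])}.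
  move=> [a b] [c d]; rewrite !inE /= => /and3P[_ /eqP a2 b3] /and3P[_ /eqP c2 d3].
  by case/set2_eq => [[-> ->]|[e _]] //; rewrite -e a2 in d3.
pose E := [set A : line_graph K | val A \in [set [set p.1; p.2] | p in X]].
have -> : #|X| = #|E|.
  rewrite -(card_in_imset inj) -(card_imset E val_inj); apply: eq_card => S.
  apply/idP/imsetP => [SX|[A + ->]]; last by rewrite inE.
  have /imsetP[[a b] abX e] := SX; have := abX; rewrite inE => /and3P[/= ab _ _].
  by exists (line_vertex ab); rewrite ?inE /= -?e.
have -> : #|heavy_darts (line_graph K)| = (\sum_A \sum_(B | (A, B) \in heavy_darts (line_graph K)) 1)%N.
  by rewrite pair_big_dep /= -sum1_card; apply: eq_bigl => -[].
rewrite -sum_nat_const [leqRHS](bigID (mem E)) /=; apply: leq_trans (leq_addr _ _).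
apply: leq_sum => /= A; rewrite inE => /imsetP[[a b]]; rewrite inE /= => /and3P[ab /eqP a2 b3] e.
have := line_branch_neighbors ab e b3; rewrite -sum1_card => /leq_trans; apply.
rewrite leq_eqVlt; apply/orP; left; apply/eqP; apply: eq_bigl => B; rewrite !inE /=.
have -> : (2 < degree (A : line_graph K))%N by rewrite (degree_line ab e); lia.
by [].
Qed.

(** This gives strictness when the line graph has no leaf. An edge at [w] with degree sum at least 5
    has degree at least 3 in the line graph; without one, all neighbours of [w] are leaves and [K]
    is a star on 4 vertices. *)
Lemma heavy_darts_gt0 (w : K) : connected K -> (4 < #|K|)%N -> (2 < degree w)%N ->
  (0 < #|heavy_darts (line_graph K)|)%N.
Proof.
move=> cK n5 w3.
have [u uw uw5] : exists2 u, adj u w & (5 <= degree u + degree w)%N.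
  case: (pickP [pred u : K | adj u w && (5 <= degree u + degree w)%N]) => [u /andP[]|no].
    by exists u.
  have [u0 wu0] : exists u, adj w u.
    have : (0 < #|[set v | adj w v]|)%N by rewrite -/(degree w); lia.
    by case/card_gt0P => u; rewrite inE; exists u.
  have le u : adj w u -> (degree u + degree w <= 4)%N.
    by move=> wu; have := no u; rewrite /= adj_sym wu /=; lia.
  have := connected_closed (P := [pred v : K | (v == w) || adj w v]) (u := w) cK.
  rewrite /= eqxx => /(_ isT) cl.
  have : (#|K| <= #|w |: [set v | adj w v]|)%N.
    rewrite -cardsT; apply/subset_leq_card/subsetP => v _; rewrite !inE.
    apply: cl => {}v z /orP[/eqP->|wv] vz; first by rewrite vz orbT.
    have := le v wv; case: eqVneq => //= zw.
    have : (2 <= degree v)%N.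
      rewrite (@leq_degree _ _ [:: w; z]) //= ?inE 1?eq_sym ?zw //.
      by rewrite adj_sym wv vz.
    by move: w3; lia.
  rewrite cardsU1 -/(degree w) inE adj_irrefl.
  by have := le _ wu0; have := degree_gt0 (etrans (adj_sym _ _) wu0); lia.
have := @line_branch_neighbors (line_vertex uw) _ _ uw erefl w3.
have u0 := degree_gt0 uw.
move/ltnW/card_gt0P => [B]; rewrite inE => /andP[AB B1].
apply/card_gt0P; exists (line_vertex uw, B); rewrite inE; apply/and3P; split=> //.
by rewrite degree_line_vertex; lia.
Qed.

End LineGraphDegrees.

Theorem theorem2p5 (R : rcfType) (K : sgraph) (n : nat)
    (hcard : #|K| = n) (hn : (5 <= n)%N) (hconn : connected K)
    (hpath : ~ isomorphic K (path_graph n))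
    (hcycle : ~ isomorphic K (cycle_graph n))
    (G : sgraph) (hG : G = line_graph K) :
  ABS R G > ABC R G.
Proof.
subst n G; rewrite -subr_gt0; apply: lt_le_trans (ABS_sub_ABC_lb R (line_graph K)).
have [w w3] : exists w : K, (2 < degree w)%N.
  case: (boolP [exists w : K, 2 < degree w]%N) => [/existsP//|/existsPn le2].
  have {}le2 (v : K) : (degree v <= 2)%N by rewrite leqNgt.
  by have [] := path_or_cycle (ltnW (ltnW hn)) hconn le2.
have W0 : (0 < #|heavy_darts (line_graph K)|%:R :> R).
  by rewrite ltr0n; apply: heavy_darts_gt0 hconn hn w3.
have : (#|leaf_darts (line_graph K)|%:R * 2 <= #|heavy_darts (line_graph K)|%:R :> R).
  rewrite -natrM ler_nat; apply: leq_trans (card_heavy_darts K).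
  rewrite leq_mul2r; apply: leq_trans (card_line_leaves hconn _) (card_leaf_threads hconn w3).
  exact: ltnW (ltnW hn).
(* With [H] heavy and [L] leaf darts, [2 * L <= H] bounds the difference below by
   [(67 - 65) / 1000 * H], which is positive. *)
lra.
Qed.
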